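(* Let $1\le p<\infty$, let $T:X_1\times\cdots\times X_m\to Y$ be an $m$-linear mapping between Banach spaces and let $\Phi:V_m\to C(B_{(X_1\otimes_\pi\cdots\otimes_\pi X_m)^*})$ be a homogeneous map. Then $T$ is strongly $\Phi$-abstract $p$-summing if and only if there are a regular Borel probability measure $\eta$ on $B_{(X_1\otimes_\pi\cdots\otimes_\pi X_m)^*}$ and a constant $C>0$ such that for all $n\in\mathbb N$, $x^{j,k}\in X_j$ and $\lambda^k\in\mathbb R$ ($j=1,\dots,m$, $k=1,\dots,n$), $$\Big\|\sum_{k=1}^n\lambda^kT(x^{1,k},\dots,x^{m,k})\Big\|\le C\Big(\int_{B_{(X_1\otimes_\pi\cdots\otimes_\pi X_m)^*}}\Big|\Phi\Big(\sum_{k=1}^n\lambda^k\langle x^{1,k}\otimes\cdots\otimes x^{m,k},\cdot\rangle\Big)\Big|^p\,d\eta\Big)^{1/p}.$$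
   Context: $X_1\otimes_\pi\cdots\otimes_\pi X_m$ is the tensor product with the projective norm; its dual is identified with the space $\mathcal L(X_1,\dots,X_m)$ of continuous scalar $m$-linear forms. $B_{(X_1\otimes_\pi\cdots\otimes_\pi X_m)^*}=B_{\mathcal L(X_1,\dots,X_m)}$ is its closed unit ball with the weak* topology (compact Hausdorff), and $C(\cdot)$ denotes the space of continuous functions with the supremum norm. For $x^j\in X_j$, $\langle x^1\otimes\cdots\otimes x^m,\cdot\rangle$ is the continuous function $\varphi\mapsto\varphi(x^1,\dots,x^m)$ on this ball, and $V_m\subset C(B_{(X_1\otimes_\pi\cdots\otimes_\pi X_m)^*})$ is the linear span of all such functions, i.e. the set of functions $\sum_{k=1}^n\lambda^k\langle x^{1,k}\otimes\cdots\otimes x^{m,k},\cdot\rangle$ with $\lambda^k\in\mathbb R$, $x^{j,k}\in X_j$. $\Phi$ (not necessarily linear) is homogeneous if $\Phi(\lambda v)=\lambda\Phi(v)$ for all real $\lambda>0$ and $v\in V_m$. $T$ is strongly $\Phi$-abstract $p$-summing if there is $C>0$ such that for all $n_1,n_2\in\mathbb N$, $x_i^{j,k}\in X_j$ and scalars $\lambda_i^k$ ($1\le i\le n_1$, $1\le k\le n_2$, $1\le j\le m$), $$\Big(\sum_{i=1}^{n_1}\Big\|\sum_{k=1}^{n_2}\lambda_i^kT(x_i^{1,k},\dots,x_i^{m,k})\Big\|^p\Big)^{1/p}\le C\Big\|\Big(\sum_{i=1}^{n_1}\Big|\Phi\Big(\sum_{k=1}^{n_2}\lambda_i^k\langle x_i^{1,k}\otimes\cdots\otimes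 x_i^{m,k},\cdot\rangle\Big)\Big|^p\Big)^{1/p}\Big\|_{C(B_{(X_1\otimes_\pi\cdots\otimes_\pi X_m)^*})}.$$ *)

(* Defs.v *)
From HB Require Import structures.
From mathcomp Require Import all_boot all_order all_algebra.
From mathcomp Require Import all_classical all_reals all_analysis.

Set Implicit Arguments.
Unset Strict Implicit.
Unset Printing Implicit Defensive.

Import Order.TTheory GRing.Theory Num.Theory.
Import numFieldNormedType.Exports.

Local Open Scope classical_set_scope.
Local Open Scope ring_scope.

Definition multilinear (R : realType) (m : nat)
    (X : 'I_m -> completeNormedModType R) (Y : lmodType R)
    (T : (forall j, X j) -> Y) : Prop :=
  forall (i : 'I_m) (x : forall j, X j),
    linear (fun u : X i => T (dfwith x i u)).

Section multilinear_forms.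
Context (R : realType) (m : nat) (X : 'I_m -> completeNormedModType R).

(* The space L(X_1, ..., X_m); continuity is for the product topology. *)
Definition cts_form : set ((forall j, X j) -> R) :=
  [set f | multilinear (f : (forall j, X j) -> R^o) /\
           continuous (f : prod_topology (fun j => X j) -> R)].

(* On [cts_form] the set is bounded, so the default value of [sup] plays no
   role. *)
Definition form_norm (f : (forall j, X j) -> R) : R :=
  sup [set `|f x| | x in [set x | forall j, `|x j| <= 1]].

Definition form_ball : set ((forall j, X j) -> R) :=
  [set f | cts_form f /\ form_norm f <= 1].

(* A list [:: (a_1, x_1); ...; (a_n, x_n)] represents the element
   \sum_k a_k x_k^1 (x) ... (x) x_k^m of the algebraic tensor product; a form f
   acts on that element by [pairing]. *)
Definition pairing (u : seq (R * (forall j, X j))) (f : (forall j, X j) -> R) :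
  R := \sum_(a <- u) a.1 * f a.2.

(* The closed unit ball of the dual of the projective tensor product, that is,
   of L(X_1, ..., X_m). It carries the weak* topology: the coarsest one making
   f |-> <u, f> continuous for every element u of the tensor product. *)
Definition dual_ball : Type := set_type form_ball.

Definition dual_ball_pairing (f : set_type form_ball) :
    {ptws seq (R * (forall j, X j)) -> R} :=
  fun u => pairing u (set_val f).

HB.instance Definition _ := Topological.copy dual_ball
  (initial_topology dual_ball_pairing).

Definition form_of (f : dual_ball) : (forall j, X j) -> R := set_val f.

Lemma form_ball0 : form_ball (fun=> 0).
Proof.
split; first split.
- by move=> i x a u v /=; rewrite scaler0 addr0.
- by apply: cst_continuous.
- rewrite /form_norm (_ : [set _ | _ in _] = [set 0]) ?sup1 ?ler01//.
  apply/seteqP; split=> [_ [x _ <-]|_ ->]/=; first by rewrite normr0.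
  by exists (fun=> 0) => [j|]; rewrite normr0.
Qed.

(* The Borel sigma-algebra below is defined in the library for pointed types. *)
HB.instance Definition _ := isPointed.Build dual_ball
  (SigSub (mem_set form_ball0) : dual_ball).

End multilinear_forms.

Section abstract_summing.
Context (R : realType) (m : nat) (X : 'I_m -> completeNormedModType R).
Local Notation K := (dual_ball X).

Definition tensor_fun (n : nat) (a : 'I_n -> R) (x : 'I_n -> forall j, X j) :
  K -> R := fun f => \sum_(k < n) a k * form_of f (x k).

Lemma continuous_tensor_fun n (a : 'I_n -> R) (x : 'I_n -> forall j, X j) :
  continuous (tensor_fun a x).
Proof.
rewrite (_ : tensor_fun a x = proj [seq (a k, x k) | k <- enum 'I_n] \o
  (@dual_ball_pairing R m X : K -> _)).
  move=> f; apply: continuous_comp; first exact: initial_continuous.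
  exact: proj_continuous.
by apply/funext => f; rewrite /= /proj /dual_ball_pairing /pairing big_map
  big_enum.
Qed.

(* C(B) is [continuousType K R]. *)
Definition tensor_cts n (a : 'I_n -> R) (x : 'I_n -> forall j, X j) :
  continuousType K R := mkcts (@continuous_tensor_fun n a x).

Definition Vset : set (continuousType K R) :=
  [set v | exists n (a : 'I_n -> R) (x : 'I_n -> forall j, X j),
     v = tensor_cts a x].

(* V_m *)
Definition Vm : Type := set_type Vset.

Lemma tensor_cts_V n (a : 'I_n -> R) (x : 'I_n -> forall j, X j) :
  Vset (tensor_cts a x).
Proof. by exists n, a, x. Qed.

Definition tensor_V n (a : 'I_n -> R) (x : 'I_n -> forall j, X j) : Vm :=
  SigSub (mem_set (tensor_cts_V a x)).

Lemma continuous_scale (c : R) (v : continuousType K R) :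
  continuous (fun f => c * v f).
Proof.
by move=> f; apply: continuousM; [apply: cst_continuous|apply: cts_fun].
Qed.

Definition scale_cts (c : R) (v : continuousType K R) : continuousType K R :=
  mkcts (@continuous_scale c v).

Lemma scale_cts_V c (v : continuousType K R) : Vset v -> Vset (scale_cts c v).
Proof.
move=> [n [a [x ->]]]; exists n, (fun k => c * a k), x.
apply/continuousEP => f /=; rewrite /scale_cts /tensor_cts /mkcts /=.
by rewrite /tensor_fun mulr_sumr; apply: eq_bigr => k _; rewrite mulrA.
Qed.

Definition scale_V (c : R) (v : Vm) : Vm :=
  SigSub (mem_set (scale_cts_V c (set_valP v))).

Definition homogeneous (Phi : Vm -> continuousType K R) : Prop :=
  forall (c : R) (v : Vm), 0 < c -> Phi (scale_V c v) = scale_cts c (Phi v).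

(* The norm of C(B), written for the underlying functions. *)
Definition sup_norm (g : K -> R) : R := sup [set `|g f| | f in [set: K]].

Definition strongly_summing (Y : completeNormedModType R)
    (Phi : Vm -> continuousType K R) (p : R) (T : (forall j, X j) -> Y) : Prop :=
  exists2 C : R, 0 < C &
    forall (n1 n2 : nat) (a : 'I_n1 -> 'I_n2 -> R)
        (x : 'I_n1 -> 'I_n2 -> forall j, X j),
      (\sum_(i < n1) `|\sum_(k < n2) a i k *: T (x i k)| `^ p) `^ p^-1 <=
      C * sup_norm (fun f =>
            (\sum_(i < n1) `|Phi (tensor_V (a i) (x i)) f| `^ p) `^ p^-1).

End abstract_summing.

Section regular_measure.
Local Open Scope ereal_scope.

Definition borel_type (T : ptopologicalType) := g_sigma_algebraType (@open T).

Definition regular_measure (R : realType) (T : ptopologicalType)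
    (eta : {measure set (borel_type T) -> \bar R}) : Prop :=
  forall A : set T, measurable (A : set (borel_type T)) ->
    eta A = ereal_inf [set eta U | U in [set U : set T | open U /\ A `<=` U]] /\
    eta A =
      ereal_sup [set eta L | L in [set L : set T | compact L /\ L `<=` A]].

End regular_measure.

(* Main.v *)
(* Idea. Let K be the weak* compact dual ball. Raised to the power p, the
   summing inequality says that every function in the convex cone Q generated by
   the ||T(w)||^p - C^p |Phi(w)|^p takes a value <= 0 on K; homogeneity of Phi
   is what makes Q closed under positive scaling. Hence
   f |-> inf_(g in Q) sup_K (f - g) is a finite sublinear functional on C(K), and
   by Hahn-Banach it dominates a linear functional, which is positive, of total
   mass 1 and <= 0 on Q. Its Riesz measure is eta. Conversely, integrating the
   domination inequality against eta bounds the sum of the ||T(w_i)||^p by the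
   maximum over K of C^p times the sum of the |Phi(w_i)|^p. *)
Require Import Defs.
From HB Require Import structures.
From mathcomp Require Import all_boot all_order all_algebra.
From mathcomp Require Import all_classical all_reals all_analysis.
From mathcomp Require Import measurable_realfun lra finmap.

Set Implicit Arguments.
Unset Strict Implicit.
Unset Printing Implicit Defensive.

Import Order.TTheory GRing.Theory Num.Theory.
Import numFieldNormedType.Exports.

Local Open Scope classical_set_scope.
Local Open Scope ring_scope.

(** * The Hahn-Banach theorem *)

(** The summing condition gives one inequality for each finite family, while a single measure has to
    serve every element of V_m. What bridges the two is that the p-th powers add up over a family:
    concatenating families adds the functions attached to them, so these already form a convex cone
    although [Phi] need not be linear. On the compact K the supremum norm is attained, so the
    condition can be read as the existence of a point for each family, and this is what keeps the
    infimum from being minus infinity. The same constant C serves in both directions. C(K) enters as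
    a subspace [E] of the space of all functions on K: functionals are total, but controlled on
    continuous functions only. *)

Section hahn_banach.
Context {R : realType} {V : lmodType R} (E : set V).
Hypothesis E0 : E 0.
Hypothesis EDZ : forall a u v, E u -> E v -> E (a *: u + v).

(** Homogeneity is an inequality only, which is easier to check for infima; [sublinearZ] recovers
    the equality by means of the factor [c^-1]. *)
Definition sublinear (q : V -> R) : Prop :=
  (forall u v, E u -> E v -> q (u + v) <= q u + q v) /\
  (forall c u, 0 <= c -> E u -> q (c *: u) <= c * q u).

Let EZ a u : E u -> E (a *: u).
Proof. by move=> Eu; rewrite -[_ *: _]addr0; exact: EDZ. Qed.

Let ED u v : E u -> E v -> E (u + v).
Proof. by move=> Eu Ev; rewrite -[u]scale1r; exact: EDZ. Qed.

Let EN u : E u -> E (- u).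
Proof. by move=> Eu; rewrite -scaleN1r; exact: EZ. Qed.

Lemma sublinear0 q : sublinear q -> q 0 = 0.
Proof.
move=> [qD qZ]; have := qD _ _ E0 E0; have := qZ 0 0 (lexx 0) E0.
rewrite addr0 scale0r mul0r => *; lra.
Qed.

Lemma sublinear_ge_opp q u : sublinear q -> E u -> - q (- u) <= q u.
Proof.
move=> sq Eu; have := sq.1 _ _ Eu (EN Eu).
by rewrite subrr (sublinear0 sq) => ?; lra.
Qed.

Lemma sublinearZ q c u : sublinear q -> 0 <= c -> E u -> q (c *: u) = c * q u.
Proof.
move=> sq; rewrite le_eqVlt => /predU1P[<- _|c0 Eu].
  by rewrite scale0r mul0r sublinear0.
apply/eqP; rewrite eq_le sq.2 ?(ltW c0)//=.
have := sq.2 c^-1 (c *: u); rewrite invr_ge0 (ltW c0) => /(_ isT (EZ c Eu)).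
by rewrite ler_pdivlMl ?scalerA ?mulVf ?gt_eqF// scale1r => ->.
Qed.

Lemma ge_mulr_inf (S : set R) (c y : R) : 0 <= c -> S !=set0 ->
  has_lbound S -> (forall x, S x -> y <= c * x) -> y <= c * inf S.
Proof.
move=> c0 S0 lS yS; have [c00|c0'] := eqVneq c 0.
  by case: S0 => x /yS; rewrite c00 !mul0r.
have cp : 0 < c by rewrite lt0r c0'.
rewrite mulrC -ler_pdivrMr//; apply: lb_le_inf => // x /yS.
by rewrite ler_pdivrMr// mulrC.
Qed.

Lemma ge_addr_inf (S S' : set R) (y : R) : S !=set0 -> S' !=set0 ->
  (forall x x', S x -> S' x' -> y <= x + x') -> y <= inf S + inf S'.
Proof.
move=> S0 S'0 yS; rewrite -lerBlDr; apply: lb_le_inf => // x Sx.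
rewrite lerBlDr -lerBlDl; apply: lb_le_inf => // x' S'x'.
by rewrite lerBlDl; exact: yS.
Qed.

(** Comparability gives subadditivity: in [s u + t v] both functionals can be replaced by the
    smaller of the two. The bound [- q (- u)] from below is common to the whole chain. *)
Lemma sublinear_inf (q : V -> R) (A : set (V -> R)) : A !=set0 ->
  (forall s t, A s -> A t -> (forall u, s u <= t u) \/ (forall u, t u <= s u)) ->
  (forall s, A s -> sublinear s /\ forall u, E u -> s u <= q u) ->
  sublinear (fun u => inf [set s u | s in A]) /\
  forall u, E u -> has_lbound [set s u | s in A].
Proof.
move=> [s0 As0] Atot Aq.
have Al u : E u -> has_lbound [set s u | s in A].
  move=> Eu; exists (- q (- u)) => _ [s As <-].
  apply: le_trans (sublinear_ge_opp (Aq _ As).1 Eu).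
  by rewrite lerN2; apply: (Aq _ As).2; exact: EN.
split=> //; split=> [u v Eu Ev|c u c0 Eu].
  apply: ge_addr_inf; [by exists (s0 u), s0|by exists (s0 v), s0|].
  move=> _ _ [s As <-] [t At <-].
  have key r : A r -> r u <= s u -> r v <= t v ->
      inf [set s (u + v) | s in A] <= s u + t v.
    move=> Ar rs rt; apply: le_trans (lerD rs rt).
    apply: le_trans ((Aq _ Ar).1.1 _ _ Eu Ev).
    by apply: ge_inf; [exact/Al/ED|exists r].
  by case: (Atot _ _ As At) => st; [apply: (key s)|apply: (key t)].
apply: ge_mulr_inf => //; [by exists (s0 u), s0|exact: Al|].
move=> _ [s As <-]; apply: le_trans ((Aq _ As).1.2 _ _ c0 Eu).
by apply: ge_inf; [exact/Al/EZ|exists s].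
Qed.

(** The parameter [r = 0] gives [q' <= q], and [r = 1] at [- h] gives the last bound. The infimum is
    finite because [r * q h = q (r *: h) <= q (u + r *: h) + q (- u)]. *)
Lemma sublinear_shift q h : sublinear q -> E h ->
  let q' u := inf [set q (u + r *: h) - r * q h | r in [set r | 0 <= r]] in
  [/\ sublinear q', forall u, E u -> q' u <= q u & q' (- h) <= - q h].
Proof.
move=> sq Eh q'.
have lq u : E u ->
    has_lbound [set q (u + r *: h) - r * q h | r in [set r | 0 <= r]].
  move=> Eu; exists (- q (- u)) => _ [r /= r0 <-].
  have := sq.1 _ _ (ED Eu (EZ r Eh)) (EN Eu).
  rewrite addrAC subrr add0r sublinearZ// => ?; lra.
have q'_le r u : 0 <= r -> E u -> q' u <= q (u + r *: h) - r * q h.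
  by move=> r0 Eu; apply: ge_inf; [exact: lq|exists r].
have ne u : [set q (u + r *: h) - r * q h | r in [set r | 0 <= r]] !=set0.
  by exists (q (u + 0 *: h) - 0 * q h), 0 => /=.
split.
- split=> [u v Eu Ev|c u c0 Eu].
    apply: ge_addr_inf => // _ _ [r /= r0 <-] [s /= s0 <-].
    apply: (le_trans (q'_le (r + s) _ (addr_ge0 r0 s0) (ED Eu Ev))).
    have := sq.1 _ _ (ED Eu (EZ r Eh)) (ED Ev (EZ s Eh)).
    by rewrite addrACA -scalerDl => ?; lra.
  apply: ge_mulr_inf => //; first exact: lq.
  move=> _ [r /= r0 <-].
  apply: (le_trans (q'_le (c * r) _ (mulr_ge0 c0 r0) (EZ c Eu))).
  rewrite mulrBr mulrA lerB// -scalerA -scalerDr.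
  by apply: sq.2 => //; exact/ED/EZ.
- by move=> u Eu; apply: (le_trans (q'_le 0 _ (lexx 0) Eu));
    rewrite scale0r mul0r addr0 subr0.
- apply: (le_trans (q'_le 1 _ ler01 (EN Eh))).
  by rewrite scale1r addNr sublinear0// mul1r sub0r.
Qed.

(* By Zorn there is a minimal sublinear functional [t] below [q]. Its shifts by
   any [h] coincide with [t] by minimality, whence [t (- h) <= - t h]: a minimal
   sublinear functional is odd, hence linear. *)
Theorem hahn_banach (q : V -> R) : sublinear q ->
  exists L : V -> R,
    (forall a u v, E u -> E v -> L (a *: u + v) = a * L u + L v) /\
    (forall u, E u -> L u <= q u).
Proof.
(* Nothing is known off [E]; setting functionals to 0 there makes the order on [E] decide the order
   on all of [V]. *)
move=> sq; pose res (s : V -> R) u := if u \in E then s u else 0.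
have resE s u : E u -> res s u = s u by rewrite /res => Eu; rewrite mem_set.
have sres s : sublinear s -> sublinear (res s).
  move=> ss; split=> [u v Eu Ev|c u c0 Eu].
    by rewrite !resE//; [exact: ss.1|exact: ED].
  by rewrite !resE//; [exact: ss.2|exact: EZ].
pose D (s : V -> R) :=
  [/\ sublinear s, forall u, E u -> s u <= q u & forall u, ~ E u -> s u = 0].
have Dres s : sublinear s -> (forall u, E u -> s u <= q u) -> D (res s).
  move=> ss sle; split; first exact: sres.
    by move=> u Eu; rewrite resE// sle.
  by move=> u nEu; rewrite /res memNset.
(* The order is reversed: a maximal element for [le] is a minimal functional. *)
pose le (s t : {s | D s}) := `[< forall u, sval t u <= sval s u >].
have [||||[t Dt] tmin] := Zorn (R := le).
- by move=> s; apply/asboolP => u.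
- move=> r s t /asboolP rs /asboolP st; apply/asboolP => u.
  exact: le_trans (st u) (rs u).
- move=> [s Ds] [t Dt] /asboolP/= st /asboolP/= ts.
  by apply/eq_exist/funext => u; apply/eqP; rewrite eq_le st ts.
- move=> A Atot; have [[a Aa]|A0] := pselect (A !=set0); last first.
    exists (exist _ _ (Dres _ sq (fun u _ => lexx _))) => s As.
    by exfalso; apply: A0; exists s.
  pose B := [set sval s | s in A].
  have [] := @sublinear_inf q B.
  + by exists (sval a), a.
  + move=> _ _ [s As <-] [t At <-].
    by case: (Atot _ _ As At) => /asboolP; [right|left].
  + by move=> _ [s As <-]; case: (svalP s).
  move=> sB lB; have BE s u : A s -> E u -> inf [set s u | s in B] <= sval s u.
    by move=> As Eu; apply: ge_inf; [exact: lB|exists (sval s) => //; exists s].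
  have Bq u : E u -> inf [set s u | s in B] <= q u.
    move=> Eu; apply: (le_trans (BE a u Aa Eu)).
    by have [_ + _] := svalP a; apply.
  exists (exist _ _ (Dres _ sB Bq)) => s As; apply/asboolP => u /=.
  have [Eu|nEu] := pselect (E u); first by rewrite resE//; exact: BE.
  by rewrite /res memNset//; have [_ _ ->] := svalP s.
have [st tq _] := Dt.
have tN h : E h -> t (- h) = - t h.
  move=> Eh; apply/le_anti/andP; split; last first.
    by have := sublinear_ge_opp st (EN Eh); rewrite opprK.
  have [ss sle sh] := sublinear_shift st Eh.
  set s := (fun u => _) in ss sle sh.
  have Ds := Dres _ ss (fun u Eu => le_trans (sle u Eu) (tq u Eu)).
  have := tmin (exist _ _ Ds); rewrite /le /=.
  have H u : res s u <= t u.
    have [Eu|nEu] := pselect (E u); first by rewrite resE//; exact: sle.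
    by rewrite /res memNset//; have [_ _ ->] := Dt.
  move=> /(_ (asboolT H))[] st'.
  suff -> : t (- h) = s (- h) by [].
  by rewrite -(resE s) ?st'//; exact: EN.
have tD u v : E u -> E v -> t (u + v) = t u + t v.
  move=> Eu Ev; apply/eqP; rewrite eq_le st.1//=.
  have := st.1 _ _ (EN Eu) (EN Ev); rewrite -opprD !tN//; last exact: ED.
  by move=> ?; lra.
have tZ a u : E u -> t (a *: u) = a * t u.
  move=> Eu; have [a0|a0] := leP 0 a; first exact: sublinearZ.
  by rewrite -[a]opprK scaleNr tN ?sublinearZ ?mulNr// ?oppr_ge0 ?ltW//; exact: EZ.
exists t; split=> // a u v Eu Ev; rewrite tD ?tZ//; exact: EZ.
Qed.

End hahn_banach.

(** * Riesz representation on a compact Hausdorff space *)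

Section real_continuous.
Context {R : realType} {K : topologicalType}.

Lemma cts_add (f g : K -> R) : continuous f -> continuous g ->
  continuous (fun x => f x + g x).
Proof.
by move=> cf cg x; apply: (@continuousD _ R^o K f g); [exact: cf|exact: cg].
Qed.

Lemma cts_sub (f g : K -> R) : continuous f -> continuous g ->
  continuous (fun x => f x - g x).
Proof.
by move=> cf cg x; apply: (@continuousB _ R^o K f g); [exact: cf|exact: cg].
Qed.

Lemma cts_lin (a : R) (f g : K -> R) : continuous f -> continuous g ->
  continuous (fun x => a * f x + g x).
Proof.
move=> cf cg; apply: cts_add => // x.
by apply: continuousM; [exact: cst_continuous|exact: cf].
Qed.

Lemma cts_mul (f g : K -> R) : continuous f -> continuous g ->
  continuous (fun x => f x * g x).
Proof. by move=> cf cg x; apply: continuousM; [exact: cf|exact: cg]. Qed.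

(* [(f - e)^+] *)
Definition excess (f : K -> R) (e : R) : K -> R :=
  fun x => Num.max (f x - e) 0.

Lemma excess_continuous (f : K -> R) e : continuous f -> continuous (excess f e).
Proof.
move=> cf x; rewrite /excess.
apply: (@continuous2_cvg _ _ _ _ _ _ (fun x => f x - e) (fun=> 0) Order.max).
- exact: (@max_continuous _ R (f x - e, 0)).

- by apply: continuousB; [exact: cf|exact: cst_continuous].
- exact: cst_continuous.
Qed.

Lemma excess_ge0 f e x : 0 <= excess f e x.
Proof. by rewrite le_max lexx orbT. Qed.

End real_continuous.

Lemma compact_max {R : realType} {K : ptopologicalType} (f : K -> R) :
  compact [set: K] -> continuous f -> exists c, forall x, f x <= f c.
Proof.
move=> cK cf; have [c _ fc] : exists2 c, c \in [set: K] &
    forall t, t \in [set: K] -> f t <= f c.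
  apply: compact_EVT_max => //; first by exists point.
  exact: continuous_subspaceT.
by exists c => x; apply: fc; rewrite in_setT.
Qed.

Lemma cts_borel_measurable {R : realType} {K : ptopologicalType} (f : K -> R) :
  continuous f -> measurable_fun [set: borel_type K] f.
Proof.
move=> /continuousP cf; apply: (measurability _ (RGenOpens.measurableE R)).
by move=> _ [_ [a [b ->] <-]]; rewrite setTI; apply: sub_sigma_algebra;
  exact/cf/interval_open.
Qed.

Section riesz.
Context {R : realType} {K : ptopologicalType}.
Hypotheses (hK : hausdorff_space K) (cK : compact [set: K]).
Variable L : (K -> R) -> R.
Hypothesis Llin : forall (a : R) (f g : K -> R), continuous f -> continuous g ->
  L (fun x => a * f x + g x) = a * L f + L g.
Hypothesis Lge0 : forall f : K -> R, continuous f -> (forall x, 0 <= f x) -> 0 <= L f.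
Hypothesis L1 : L (fun=> 1) = 1.

Let c0 (a : R) : continuous (fun _ : K => a).
Proof. exact: cst_continuous. Qed.

Let LD (f g : K -> R) : continuous f -> continuous g ->
  L (fun x => f x + g x) = L f + L g.
Proof.
move=> cf cg; rewrite -[L f]mul1r -Llin//; congr L.
by apply/funext => x; rewrite mul1r.
Qed.

Let LB (f g : K -> R) : continuous f -> continuous g ->
  L (fun x => f x - g x) = L f - L g.
Proof.
move=> cf cg; rewrite -mulN1r addrC -Llin//; congr L.
by apply/funext => x; rewrite mulN1r addrC.
Qed.

Let Lmono (f g : K -> R) : continuous f -> continuous g -> (forall x, f x <= g x) ->
  L f <= L g.
Proof.
move=> cf cg fg; rewrite -subr_ge0 -LB//; apply: Lge0; first exact: cts_sub.
by move=> x; rewrite subr_ge0.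
Qed.

Let L0 : L (fun=> 0) = 0.
Proof.
rewrite -[RHS](subrr (L (fun=> 1))) -LB//; congr L.
by apply/funext => x; rewrite subrr.
Qed.

Let LZ a (f : K -> R) : continuous f -> L (fun x => a * f x) = a * L f.
Proof.
move=> cf; have := Llin a cf (@c0 0); rewrite L0 addr0 => <-; congr L.
by apply/funext => x; rewrite addr0.
Qed.

(** Since [f <= e + excess f e] and [L] has total mass 1, truncation costs at most [e]. *)
Let L_excess (f : K -> R) e : continuous f -> L f <= L (excess f e) + e.
Proof.
move=> cf; have -> : L (excess f e) + e = L (fun x => e * 1 + excess f e x).
  by rewrite Llin ?L1 ?mulr1 1?addrC//; exact: excess_continuous.
apply: Lmono => //; first exact/cts_lin/excess_continuous.
by move=> x; rewrite /excess mulr1 -lerBlDl le_max lexx.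
Qed.

(** Vanishing off [U] stands in for the usual support condition. Proofs pass to [excess f e], which
    vanishes off the closed set [f >= e]; that set lies in [U] when [e > 0]. *)
Definition below (U : set K) (f : K -> R) : Prop :=
  continuous f /\ forall x, 0 <= f x <= \1_U x.

Lemma belowP U (f : K -> R) : continuous f -> (forall x, 0 <= f x) ->
  (forall x, f x <= 1) -> (forall x, ~ U x -> f x = 0) -> below U f.
Proof.
move=> cf f0 f1 fU; split => // x; rewrite f0 indicE/=.
by have [Ux|nUx] := pselect (U x); [rewrite mem_set|rewrite memNset// fU].
Qed.

Lemma below_le1 U f x : below U f -> f x <= 1.
Proof.
move=> [_ /(_ x)/andP[_ /le_trans]]; apply.
by rewrite indicE; case: (_ \in _).
Qed.

Lemma below_ge0 U f x : below U f -> 0 <= f x.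
Proof. by move=> [_ /(_ x)/andP[]]. Qed.

Lemma below_eq0 U f x : below U f -> ~ U x -> f x = 0.
Proof.
by move=> [_ /(_ x)] + nU; rewrite indicE memNset//= => /le_anti <-.
Qed.

Lemma below_excess U f e : 0 <= e -> below U f -> below U (excess f e).
Proof.
move=> e0 Uf; apply: belowP => [||x|x nU].
- by apply: excess_continuous; case: Uf.
- exact: excess_ge0.
- by rewrite /excess ge_max ler01 lerBlDr (le_trans (below_le1 x Uf))// lerDl.
- by rewrite /excess (below_eq0 Uf nU) sub0r max_r// oppr_le0.
Qed.

Lemma below_sub U V f : U `<=` V -> below U f -> below V f.
Proof.
move=> UV Uf; apply: belowP.
- by case: Uf.
- by move=> x; exact: below_ge0 Uf.
- by move=> x; exact: below_le1 Uf.
- by move=> x nV; apply: (below_eq0 Uf) => /UV.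
Qed.

Lemma closed_superlevel (f : K -> R) e : continuous f ->
  closed [set x | e <= f x].
Proof. by move=> cf; apply: (preimage_closed _ (@closed_ge R e)) => x _; exact: cf. Qed.

Lemma open_superlevel (f : K -> R) e : continuous f ->
  open [set x | e < f x].
Proof. by move=> cf; apply: (open_comp _ (@open_gt R e)) => x _; exact: cf. Qed.

Local Open Scope ereal_scope.

(** The value that the Riesz measure will take on open sets; [riesz_outer] extends it to all sets by
    outer regularity. *)
Definition capacity (U : set K) : \bar R := ereal_sup [set (L f)%:E | f in below U].

Definition riesz_outer (A : set K) : \bar R :=
  ereal_inf [set capacity U | U in [set U | open U /\ A `<=` U]].

Lemma below0 U : below U (fun=> 0%R).
Proof. exact: belowP. Qed.

Lemma le_capacity U f : below U f -> (L f)%:E <= capacity U.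
Proof. by move=> Uf; apply: ereal_sup_ubound; exists f. Qed.

Lemma capacity_le U M : (forall f, below U f -> (L f)%:E <= M) -> capacity U <= M.
Proof. by move=> UM; apply: ge_ereal_sup => _ [f Uf <-]; exact: UM. Qed.

Lemma capacity_ge0 U : 0 <= capacity U.
Proof. by apply: le_trans (le_capacity (below0 U)); rewrite L0. Qed.

Lemma capacity_sub U V : U `<=` V -> capacity U <= capacity V.
Proof.
by move=> UV; apply: capacity_le => f /(below_sub UV); exact: le_capacity.
Qed.

Lemma capacity_set0 : capacity set0 = 0.
Proof.
apply: le_anti; rewrite capacity_ge0 andbT; apply: capacity_le => f f0.
rewrite (_ : f = fun=> 0%R) ?L0//; apply/funext => x.
by rewrite (below_eq0 f0).
Qed.

Lemma capacity_setT : capacity setT = 1.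
Proof.
apply: le_anti; apply/andP; split.
  apply: capacity_le => f f1; rewrite -L1 lee_fin; apply: Lmono => //.
    by case: f1.
  by move=> x; exact: below_le1 f1.
by rewrite -L1; apply: le_capacity; apply: belowP => // x [].
Qed.

Lemma capacityU U V : open U -> open V ->
  capacity (U `|` V) <= capacity U + capacity V.
Proof.
move=> oU oV; apply: capacity_le => f UVf; apply/lee_addgt0Pr => e e0.
have [cf _] := UVf; have cg := excess_continuous (e := e) cf.
pose M := [set x | (e <= f x)%R].
have clM : closed M := closed_superlevel cf.
have MUV : (M `\` U) `&` (M `\` V) = set0.
  rewrite -subset0 => x [[/= Mx nU] [_ nV]].
  move: Mx; rewrite /M/= (below_eq0 UVf) ?leNgt ?e0//.
  by case.
have clD W : open W -> closed (M `\` W).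
  by move=> oW; rewrite setDE; apply: closedI => //; exact: open_closedC.
(* A Urysohn function [h], 0 on [M `\` U] and 1 on [M `\` V], splits
   [excess f e] into a part below [U] and a part below [V]. *)
have := normal_uniform_separator (compact_normal hK cK) (clD _ oU) (clD _ oV) MUV.
move=> /(@uniform_separatorP _ R)[h [ch h01 h0 h1]].
have h_itv x : (0 <= h x <= 1)%R.
  by have := h01 (h x); rewrite /= in_itv/=; apply; exists x.
have gM x : ~ M x -> excess f e x = 0%R.
  move=> /negP; rewrite -ltNge => fe; rewrite /excess max_r//.
  by rewrite subr_le0 ltW.
have g1 x : (excess f e x <= 1)%R by exact: below_le1 (below_excess (ltW e0) UVf).
have Uh : below U (fun x => excess f e x * h x)%R.
  apply: belowP; [exact: cts_mul|..] => x.
  - by rewrite mulr_ge0 ?excess_ge0//; case/andP: (h_itv x).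
  - by rewrite mulr_ile1 ?excess_ge0//; case/andP: (h_itv x).
  - move=> nU; have [Mx|nM] := pselect (M x); last by rewrite gM// mul0r.
    by rewrite (h0 (h x)) ?mulr0//; exists x.
have Vh : below V (fun x => excess f e x * (1 - h x))%R.
  apply: belowP => [|x|x|x].
  - by apply: cts_mul => //; apply: cts_sub => //; exact: c0.
  - by rewrite mulr_ge0 ?excess_ge0// subr_ge0; case/andP: (h_itv x).
  - by rewrite mulr_ile1 ?excess_ge0// ?subr_ge0 ?gerBl; case/andP: (h_itv x).
  - move=> nV; have [Mx|nM] := pselect (M x); last by rewrite gM// mul0r.
    by rewrite (h1 (h x)) ?subrr ?mulr0//; exists x.
apply: (@le_trans _ _ (L (excess f e) + e)%:E); first by rewrite lee_fin L_excess.
rewrite EFinD leeD2r//; apply: le_trans (leeD (le_capacity Uh) (le_capacity Vh)).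
rewrite -EFinD lee_fin -LD; [|by case: Uh|by case: Vh].
rewrite le_eqVlt; apply/orP; left; apply/eqP; congr L; apply/funext => x.
by rewrite -mulrDr addrC subrK mulr1.
Qed.

Lemma capacity_bigsetU (F : (set K)^nat) n : (forall i, open (F i)) ->
  capacity (\big[setU/set0]_(i < n) F i) <= \sum_(i < n) capacity (F i).
Proof.
move=> oF; elim: n => [|n ih]; first by rewrite !big_ord0 capacity_set0.
rewrite !big_ord_recr/=; apply: (le_trans (capacityU _ _)) => //.
  by rewrite -bigcup_mkord; exact: bigcup_open.
exact: leeD2r.
Qed.

(** The set [f >= e] is compact, so finitely many [F i] cover it and [excess f e] is below a finite
    union. *)
Lemma capacity_bigcup (F : (set K)^nat) : (forall i, open (F i)) ->
  capacity (\bigcup_i F i) <= \sum_(i <oo) capacity (F i).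
Proof.
move=> oF; apply: capacity_le => f Ff; apply/lee_addgt0Pr => e e0.
have [cf _] := Ff; pose M := [set x | (e <= f x)%R].
have cM : compact M.
  by apply: (subclosed_compact _ cK) => //; exact: closed_superlevel.
move: cM; rewrite compact_cover => /(_ _ setT F)[//||D _ MD].
  move=> x Mx; apply: contrapT => nF; move: Mx.
  by rewrite /M/= (below_eq0 Ff nF) leNgt e0.
(* The successor makes every index in [D] strictly less than [n]. *)
pose n := (\max_(i <- D) i.+1)%N.
have Fn : below (\big[setU/set0]_(i < n) F i) (excess f e).
  have := below_excess (ltW e0) Ff => Fg.
  apply: belowP; [by case: Fg|exact: excess_ge0| |] => x.
    exact: below_le1 Fg.
  move=> nFn; rewrite /excess max_r// subr_le0 leNgt; apply/negP => fe.
  have [i Di Fi] := MD x (ltW fe); apply: nFn.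
  rewrite -bigcup_mkord; exists i => //=.
  by apply: (leq_trans (ltnSn i)); exact: leq_bigmax_seq.
apply: (@le_trans _ _ (L (excess f e) + e)%:E); first by rewrite lee_fin L_excess.
rewrite EFinD leeD2r//; apply: (le_trans (le_capacity Fn)).
apply: (le_trans (capacity_bigsetU _ oF)).
rewrite -(big_mkord xpredT (fun i => capacity (F i))).
by apply: nneseries_lim_ge => i _ _; exact: capacity_ge0.
Qed.

Lemma riesz_outer_le A U : open U -> A `<=` U -> riesz_outer A <= capacity U.
Proof. by move=> oU AU; apply: ereal_inf_lbound; exists U. Qed.

Lemma riesz_outer_ge A M :
  (forall U, open U -> A `<=` U -> M <= capacity U) -> M <= riesz_outer A.
Proof. by move=> AM; apply: le_ereal_inf_tmp => _ [U [oU AU] <-]; exact: AM. Qed.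

Lemma riesz_outer_open U : open U -> riesz_outer U = capacity U.
Proof.
move=> oU; apply: le_anti; rewrite riesz_outer_le//=.
by apply: riesz_outer_ge => V _; exact: capacity_sub.
Qed.

Lemma riesz_outer_ge0 A : 0 <= riesz_outer A.
Proof. by apply: riesz_outer_ge => U _ _; exact: capacity_ge0. Qed.

Lemma riesz_outer0 : riesz_outer set0 = 0.
Proof. by rewrite riesz_outer_open ?capacity_set0//; exact: open0. Qed.

Lemma riesz_outer_homo : {homo riesz_outer : A B / A `<=` B >-> A <= B}.
Proof.
move=> A B AB; apply: riesz_outer_ge => U oU BU.
by apply: riesz_outer_le => // x /AB/BU.
Qed.

Lemma riesz_outer_fin_num A : riesz_outer A \is a fin_num.
Proof.
rewrite ge0_fin_numE ?riesz_outer_ge0//.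
apply: (@le_lt_trans _ _ (capacity setT)); last by rewrite capacity_setT ltry.
by apply: riesz_outer_le => //; exact: openT.
Qed.

Lemma riesz_outer_sigma_subadditive : sigma_subadditive riesz_outer.
Proof.
move=> F; apply/lee_addgt0Pr => e e0.
apply: le_trans (epsilon_trick xpredT (fun n => riesz_outer_ge0 (F n)) (ltW e0)).
have /choice[U FU] n : exists U, [/\ open U, F n `<=` U &
    capacity U <= riesz_outer (F n) + (e / (2 ^ n.+1)%:R)%:E].
  have en : (0 < e / (2 ^ n.+1)%:R)%R by rewrite divr_gt0// ltr0n expn_gt0.
  have [_ [U [oU FU] <-] /ltW UF] :=
    lb_ereal_inf_adherent en (riesz_outer_fin_num (F n)).
  by exists U.
apply: (@le_trans _ _ (capacity (\bigcup_n U n))).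
  apply: riesz_outer_le; first by apply: bigcup_open => n _; case: (FU n).
  by move=> x [n _ Fx]; exists n => //; case: (FU n) => _ + _; apply.
apply: (le_trans (capacity_bigcup _)); first by move=> n; case: (FU n).
by apply: lee_nneseries => n *; [exact: capacity_ge0|case: (FU n)].
Qed.

(* If [f] is below [W `&` U] and [g] is below [W] minus the closed set
   [f >= e], then [excess f e + g] is again below [W]. *)
Lemma riesz_outer_open_caratheodory U A : open U ->
  riesz_outer (A `&` U) + riesz_outer (A `&` ~` U) <= riesz_outer A.
Proof.
move=> oU; apply: riesz_outer_ge => W oW AW.
have oWU : open (W `&` U) by exact: openI.
apply: (@le_trans _ _ (capacity (W `&` U) + riesz_outer (W `&` ~` U))).
  apply: leeD; last by apply: riesz_outer_homo; exact: setSI.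
  by rewrite -riesz_outer_open//; apply: riesz_outer_homo; exact: setSI.
rewrite -leeBrDr ?riesz_outer_fin_num//; apply: capacity_le => f fWU.
rewrite leeBrDr ?riesz_outer_fin_num//; apply/lee_addgt0Pr => e e0.
have [cf _] := fWU; pose M := [set x | (e <= f x)%R].
have oM : open (W `&` ~` M).
  by apply: openI => //; apply/closed_openC/closed_superlevel.
apply: (@le_trans _ _ ((L f)%:E + capacity (W `&` ~` M))).
  rewrite leeD2l//; apply: riesz_outer_le => // x [Wx nUx]; split => //.
  by rewrite /M/= (below_eq0 fWU) => [|[]//]; apply/negP; rewrite -ltNge.
rewrite addeC -leeBrDr//; apply: capacity_le => g gWM.
rewrite leeBrDr//; have [cg _] := gWM.
apply: (@le_trans _ _ (L (fun x => excess f e x + g x)%R + e)%:E).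
  rewrite LD//; last exact: excess_continuous.
  rewrite -EFinD lee_fin; have := L_excess e cf; lra.
rewrite EFinD leeD2r//; apply: le_capacity.
have fg := below_excess (ltW e0) fWU.
apply: belowP => [|x|x|x nW].
- exact/cts_add/cg/excess_continuous.
- by rewrite addr_ge0 ?excess_ge0//; exact: below_ge0 gWM.
- have [Mx|/negP] := pselect (M x).
    by rewrite (below_eq0 gWM) ?addr0; [exact: below_le1 fg|case].
  rewrite -ltNge => fe; rewrite {1}/excess max_r ?add0r; first exact: below_le1 gWM.
  by rewrite subr_le0 ltW.
- by rewrite (below_eq0 fg) ?(below_eq0 gWM) ?addr0//; case.
Qed.

Definition riesz_outer_measure : {outer_measure set K -> \bar R} :=
  HB.pack riesz_outer
    (isOuterMeasure.Build R K riesz_outer riesz_outer0 riesz_outer_ge0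
      riesz_outer_homo riesz_outer_sigma_subadditive).

Lemma borel_riesz_caratheodory : <<s @open K >> `<=` riesz_outer.-caratheodory.
Proof.
apply: smallest_sub; last first.
  move=> U oU; apply: (@le_caratheodory_measurable _ _ riesz_outer_measure) => A.
  exact: riesz_outer_open_caratheodory.
split=> [|A mA|F mF].
- exact: (caratheodory_measurable_set0 riesz_outer_measure).
- by rewrite setTD; exact: (@caratheodory_measurable_setC _ _ riesz_outer_measure).
- exact: (@caratheodory_measurable_bigcup _ _ riesz_outer_measure).
Qed.

(** The equation holds on all subsets of [K], a bundled measure being a total function; outer
    regularity is then built in. *)
Lemma riesz_outer_probability :
  exists eta : probability (borel_type K) R, (eta : set K -> \bar R) = riesz_outer.
Proof.
have mu_sadd : semi_sigma_additive (riesz_outer : set (borel_type K) -> \bar R).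
  move=> F mF tF mUF.
  apply: (@caratheodory_measure_sigma_additive _ _ riesz_outer_measure) => //.
    by move=> i; apply: borel_riesz_caratheodory; exact: mF.
  exact: borel_riesz_caratheodory.
pose nu : {measure set (borel_type K) -> \bar R} := HB.pack
  (riesz_outer : set (borel_type K) -> \bar R)
  (isMeasure.Build _ (borel_type K) R riesz_outer riesz_outer0
    riesz_outer_ge0 mu_sadd).
have nuT : nu setT = 1.
  by rewrite /nu/= riesz_outer_open ?capacity_setT//; exact: openT.
pose eta : probability (borel_type K) R := HB.pack
  (riesz_outer : set (borel_type K) -> \bar R) (Measure.class nu)
  (Measure_isProbability.Build _ (borel_type K) R nu nuT).
by exists eta.
Qed.

(** Inner regularity is outer regularity of the complement: if an open [U] contains the complement
    of [A] and exceeds it by at most [e] in measure, then the complement of [U] is compact, lies in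
    [A] and loses at most [e]. *)
Lemma riesz_outer_regular (eta : probability (borel_type K) R) :
  (eta : set K -> \bar R) = riesz_outer -> regular_measure eta.
Proof.
move=> etaE; have outer (A : set K) :
    eta A = ereal_inf [set eta U | U in [set U : set K | open U /\ A `<=` U]].
  rewrite etaE; congr ereal_inf; apply/seteqP.
  by split=> _ [U [oU AU] <-]; exists U => //; rewrite riesz_outer_open.
move=> A mA; split; first exact: outer.
apply: le_anti; apply/andP; split; last first.
  apply: ge_ereal_sup => _ [M [_ MA] <-].
  by have := riesz_outer_homo MA; rewrite -etaE.
have mC : measurable (~` A : set (borel_type K)) by exact: measurableC.
have etaC (B : set (borel_type K)) : measurable B -> eta B = 1 - eta (~` B).
  by move=> mB; rewrite -[in LHS](setCK B) probability_setC//; exact: measurableC.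
apply/lee_addgt0Pr => e e0; rewrite [leLHS](etaC A mA).
have fC : eta (~` A) \is a fin_num by exact: fin_num_measure.
have := outer (~` A) => etaCA.
have [] := @lb_ereal_inf_adherent R _ e e0
  (eq_ind _ (fun x => x \is a fin_num) fC _ etaCA).
move=> _ [U [oU AU] <-]; rewrite -etaCA => /ltW Ue.
have mU : measurable (U : set (borel_type K)) by exact: sub_sigma_algebra.
apply: (@le_trans _ _ (eta (~` U) + e%:E)); last first.
  rewrite leeD2r//; apply: ereal_sup_ubound; exists (~` U) => //; split.
    by apply: (subclosed_compact _ cK) => //; exact: open_closedC.
  by move=> x nU; apply: contrapT => nA; exact/nU/AU.
have fU : eta U \is a fin_num by exact: fin_num_measure.
rewrite [eta (~` U)]probability_setC//; move: Ue.
rewrite -(fineK fC) -(fineK fU) -!EFinB -!EFinD !lee_fin => ?; lra.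
Qed.

(** * Integration against the Riesz measure *)

Lemma riesz_integral_le (eta : probability (borel_type K) R) (g : K -> R) :
  (eta : set K -> \bar R) = riesz_outer -> continuous g ->
  (forall x, 0 <= g x)%R -> (L g)%:E <= \int[eta]_x (g x)%:E.
Proof.
move=> etaE cg g0; apply/lee_addgt0Pr => e e0.
pose F k := excess g (k%:R * e).
have cF k : continuous (F k) by exact: excess_continuous.
have mF k : measurable_fun [set: borel_type K] (F k).
  exact: cts_borel_measurable.
have F_le k x : (F k.+1 x <= F k x)%R.
  rewrite /F /excess ge_max !le_max lexx orbT andbT -natr1.
  by rewrite lerD2l lerN2 mulrDl mul1r lerDl ltW.
have F0 : F 0%N = g.
  by apply/funext => x; rewrite /F /excess mul0r subr0 max_l.
pose U k := [set x | (k.+1%:R * e < g x)%R].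
have oU k : open (U k) by exact: open_superlevel.
have mU k : measurable (U k : set (borel_type K)) by exact: sub_sigma_algebra.
have FS k x : (F k x <= F k.+1 x + e)%R.
  rewrite /F /excess ge_max -lerBlDr le_max; apply/andP; split.
    by rewrite -natr1 mulrDl mul1r opprD addrA lexx.
  by rewrite addr_ge0 ?excess_ge0 ?(ltW e0).
have F_eq0 k x : (g x <= k%:R * e)%R -> F k x = 0%R.
  by move=> gk; rewrite /F /excess max_r// subr_le0.
have mFB i j : measurable_fun [set: borel_type K] (EFin \o (fun x => F i x - F j x)%R).
  by apply/measurable_EFinP; exact: measurable_funB.
(* [F k - F k.+1] is the slice of [g] between the levels [k e] and [k.+1 e];
   [e * \1_(U k)] lies above slice [k.+1] and below slice [k]. *)
have slice k : (L (F k.+1) - L (F k.+2))%:E <= \int[eta]_x (F k x - F k.+1 x)%:E.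
  apply: (@le_trans _ _ (e%:E * eta (U k))).
    rewrite etaE riesz_outer_open// -lee_pdivrMl// -EFinM -LB// -LZ.
      apply: le_capacity; apply: belowP => [|x|x|x].
      - by apply: cts_mul; [exact: cst_continuous|exact: cts_sub].
      - by rewrite mulr_ge0 ?invr_ge0 ?subr_ge0 ?(ltW e0).
      - by rewrite ler_pdivrMl// mulr1 lerBlDl.
      - move=> /negP; rewrite -leNgt => gk; rewrite !F_eq0 ?subrr ?mulr0//.
        by apply: (le_trans gk); rewrite ler_wpM2r ?(ltW e0)// ler_nat.
    exact: cts_sub.
  rewrite -[X in eta X]setIT -integral_indic// -ge0_integralZl//; last 2 first.
  - by apply/measurable_EFinP; exact: measurable_indic.
  - by rewrite lee_fin ltW.
  apply: ge0_le_integral => //.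
  - by move=> x _; rewrite -EFinM lee_fin mulr_ge0// ltW.
  - by under eq_fun do rewrite -EFinM; apply/measurable_EFinP/measurable_funM.
  - exact: mFB.
  move=> x _; rewrite -EFinM lee_fin indicE.
  have [Ux|nUx] := pselect (U k x); last by rewrite memNset// mulr0 subr_ge0.
  rewrite mem_set// mulr1 /F /excess max_l; last first.
    by rewrite subr_ge0 (le_trans _ (ltW Ux))// ler_wpM2r ?(ltW e0)// ler_nat.
  rewrite max_l; last by rewrite subr_ge0 ltW.
  by rewrite -natr1; lra.
have F_le0 n x : (F n x <= F 0%N x)%R.
  by elim: n => // n; exact: le_trans.
have sum n : (L (F 1%N) - L (F n.+1))%:E <= \int[eta]_x (F 0%N x - F n x)%:E.
  elim: n => [|n ih].
    by rewrite subrr; apply: integral_ge0 => x _; rewrite subrr.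
  rewrite -(subrKA (L (F n.+1))) EFinD.
  apply: (le_trans (leeD ih (slice n))); rewrite -ge0_integralD//;
    [|by move=> x _; rewrite lee_fin subr_ge0|exact: mFB|
      by move=> x _; rewrite lee_fin subr_ge0|exact: mFB].
  by under eq_integral do rewrite -EFinD subrKA.
have [c gc] := compact_max cK cg.
(* By compactness [g] stays below some level [n * e], so finitely many slices exhaust it. *)
have [n gn] : exists n, forall x, (g x <= n%:R * e)%R.
  exists (Num.truncn (g c / e)).+1 => x; rewrite -ler_pdivrMr//.
  apply: le_trans (ltW (truncnS_gt _)).
  by rewrite ler_pM2r ?invr_gt0// gc.
(* Comparing slice [k.+1] with slice [k] leaves out the lowest slice, on which [L] is at most
   [e]. *)
apply: (@le_trans _ _ (L (F 1%N) + e)%:E).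
  by rewrite lee_fin /F mul1r L_excess.
rewrite EFinD leeD2r//; have := sum n.
rewrite (_ : F n.+1 = fun=> 0%R); last first.
  apply/funext => x; apply: F_eq0; apply: (le_trans (gn x)).
  by rewrite ler_wpM2r ?(ltW e0)// ler_nat.
rewrite L0 subr0 => /le_trans; apply; apply: ge0_le_integral => //.
- by move=> x _; rewrite lee_fin subr_ge0.
- exact: mFB.
- by apply/measurable_EFinP; exact: cts_borel_measurable.
- by move=> x _; rewrite lee_fin F0 lerBlDr lerDl excess_ge0.
Qed.

(** The reverse inequality comes from [riesz_integral_le] for [g c - g], where [g c] is the maximum
    of [g]: on the sum of the two functions [L] and the integral both equal [g c]. *)
Theorem riesz_representation : exists eta : probability (borel_type K) R,
  regular_measure eta /\
  forall g : K -> R, continuous g -> (forall x, 0 <= g x)%R ->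
    (L g)%:E = \int[eta]_x (g x)%:E.
Proof.
have [eta etaE] := riesz_outer_probability.
exists eta; split=> [|g cg g0]; first exact: riesz_outer_regular.
apply: le_anti; rewrite riesz_integral_le//=.
have [c gc] := compact_max cK cg.
pose h x : R := (g c - g x)%R.
have ch : continuous h by apply: cts_sub => //; exact: cst_continuous.
have h0 x : (0 <= h x)%R by rewrite subr_ge0 gc.
have mE (f : K -> R) : continuous f -> measurable_fun [set: borel_type K] (EFin \o f).
  by move=> cf; apply/measurable_EFinP; exact: cts_borel_measurable.
have gh : \int[eta]_x (g x)%:E + \int[eta]_x (h x)%:E = (g c)%:E.
  rewrite -ge0_integralD//;
    [|by move=> x _; rewrite lee_fin|exact: mE|by move=> x _; rewrite lee_fin|exact: mE].
  under eq_integral do rewrite -EFinD addrC subrK.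
  by rewrite integral_cst// [X in _ * X]probability_setT mule1.
have Lgh : (L g + L h = g c)%R.
  rewrite /h LB// addrC subrK; transitivity (g c * L (fun=> 1))%R.
    by rewrite -LZ//; congr L; apply/funext => x; rewrite mulr1.
  by rewrite L1 mulr1.
have := riesz_integral_le etaE ch h0; move: gh.
case: (\int[eta]_x (g x)%:E) (\int[eta]_x (h x)%:E) => [a| |] [b| |]//.
by move=> [ab]; rewrite !lee_fin => ?; lra.
Qed.

End riesz.

(** * Measures dominating a cone *)

Section convex_cone.
Context {R : realType} {K : ptopologicalType}.
Hypotheses (hK : hausdorff_space K) (cK : compact [set: K]).

Variable Q : set (K -> R).
Hypothesis Q0 : Q (fun=> 0).
Hypothesis QD : forall f g, Q f -> Q g -> Q (fun x => f x + g x).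
Hypothesis QZ : forall c f, 0 <= c -> Q f -> Q (fun x => c * f x).
Hypothesis Q_le0 : forall f, Q f -> exists x, f x <= 0.

(* [inf (ub f)] is the infimum over [g] in [Q] of [sup (f - g)]. *)
Let ub (f : K -> R) : set R :=
  [set M | exists2 g, Q g & forall x, f x <= g x + M].

(** At a point [x] where [g x <= 0] the bound forces [M >= f x], so [M] is at least the minimum of
    [f]. *)
Let ub_lb (f : K -> R) : continuous f -> has_lbound (ub f).
Proof.
move=> cf; have [c fc] := compact_max cK (cts_sub (@cst_continuous _ _ 0) cf).
exists (f c) => M [g Qg fg]; have [x gx] := Q_le0 Qg.
have := fg x; have := fc x; lra.
Qed.

Let ub_nonempty (f : K -> R) : continuous f -> ub f !=set0.
Proof.
move=> cf; have [c fc] := compact_max cK cf.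
by exists (f c), (fun=> 0) => // x; rewrite add0r.
Qed.

Let inf_ub_le (f g : K -> R) M : continuous f -> Q g ->
  (forall x, f x <= g x + M) -> inf (ub f) <= M.
Proof. by move=> cf Qg fg; apply: ge_inf; [exact: ub_lb|exists g]. Qed.

(** Each property comes from a choice of [g] in [Q] and of [M]: [g = 0] and [M = 0] for the negative
    of a nonnegative function, [g = 0] and [M = 1] or [-1] for the constants 1 and -1, [g = f] and
    [M = 0] for [f] in [Q]. *)
Lemma separating_functional : exists L : (K -> R) -> R,
  [/\ forall (a : R) (f g : K -> R), continuous f -> continuous g ->
        L (fun x => a * f x + g x) = a * L f + L g,
      forall f : K -> R, continuous f -> (forall x, 0 <= f x) -> 0 <= L f,
      L (fun=> 1) = 1 &
      forall f : K -> R, continuous f -> Q f -> L f <= 0].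
Proof.
have c0 (a : R) : continuous (fun _ : K => a) by exact: cst_continuous.
pose E : set (K -> R^o) := [set f | continuous (f : K -> R)].
have E0 : E 0 by exact: c0.
have EDZ a (u v : K -> R^o) : E u -> E v -> E (a *: u + v) by exact: cts_lin.
have sq : sublinear E (fun f => inf (ub f)).
  split=> [u v cu cv|c u c_ge0 cu].
    apply: ge_addr_inf; [exact: ub_nonempty|exact: ub_nonempty|].
    move=> M N [g Qg ug] [h Qh vh].
    apply: (inf_ub_le (cts_add cu cv) (QD Qg Qh)) => x.
    by have := ug x; have := vh x; lra.
  apply: ge_mulr_inf => //; [exact: ub_nonempty|exact: ub_lb|].
  move=> M [g Qg ug]; apply: (inf_ub_le _ (QZ c_ge0 Qg)) => [|x].
    by apply: cts_mul => //; exact: c0.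
  by rewrite -mulrDr ler_wpM2l.
have [L [Llin Lq]] := hahn_banach E0 EDZ sq.
have L_le (f g : K -> R) M : continuous f -> Q g ->
    (forall x, f x <= g x + M) -> L f <= M.
  by move=> cf Qg fg; apply: (le_trans (Lq f cf)); exact: inf_ub_le fg.
have LZ a (f : K -> R) : continuous f -> L (fun x => a * f x) = a * L f.
  move=> cf; have L0 : L 0 = 0.
    by have := Llin (-1) 0 0 E0 E0; rewrite scaler0 addr0; lra.
  by have := Llin a f 0 cf E0; rewrite !addr0 L0 addr0.
exists L; split=> [a f g cf cg|f cf f0||f cf Qf].
- exact: Llin.
- have : L (fun x => -1 * f x) <= 0.
    apply: (L_le _ (fun=> 0)) => // [|x]; first exact: cts_mul.
    by rewrite addr0 mulN1r oppr_le0.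
  by rewrite LZ// mulN1r oppr_le0.
- have : L (fun=> 1) <= 1.
    by apply: (L_le _ (fun=> 0)) => // x; rewrite add0r.
  have : L (fun=> -1 * 1) <= -1.
    by apply: (L_le _ (fun=> 0)) => // x; rewrite add0r mulr1.
  by rewrite (LZ (-1) (fun=> 1)); [lra|exact: c0].
- by apply: (L_le _ f) => // x; rewrite addr0.
Qed.

(** [riesz_representation] covers nonnegative integrands, hence the form [a - h] for elements of
    [Q]. *)
Lemma separating_measure : exists eta : probability (borel_type K) R,
  regular_measure eta /\
  forall (a : R) (h : K -> R), continuous h -> (forall x, 0 <= h x) ->
    Q (fun x => a - h x) -> (a%:E <= \int[eta]_x (h x)%:E)%E.
Proof.
have [L [Llin Lge0 L1 LQ]] := separating_functional.
have [eta [reg Leta]] := riesz_representation hK cK Llin Lge0 L1.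
exists eta; split=> // a h ch h0 Qh; rewrite -Leta// lee_fin.
have cst1 : continuous (fun _ : K => 1 : R) by exact: cst_continuous.
have csta : continuous (fun _ : K => a) by exact: cst_continuous.
have := LQ _ (cts_sub csta ch) Qh.
have La : L (fun=> a) = a.
  transitivity (L (fun=> (a - 1) * 1 + 1)).
    by congr L; apply/funext => x; rewrite mulr1 subrK.
  by rewrite Llin// L1 mulr1 subrK.
have -> : L (fun x => a - h x) = - 1 * L h + L (fun=> a).
  by rewrite -Llin//; congr L; apply/funext => x; rewrite mulN1r addrC.
by rewrite La mulN1r addrC subr_le0.
Qed.

End convex_cone.

(** * Weak* compactness of the dual ball *)

Lemma cvg_initial (S : choiceType) (T : topologicalType) (f : S -> T)
    (F : set_system S) (s : initial_topology f) : Filter F ->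
  f @ F --> f s -> F --> s.
Proof.
move=> FF Fs A [_ [[B oB <-] Bs BA]]; apply: (filterS BA).
by apply: Fs; exact: open_nbhs_nbhs.
Qed.

Lemma cvg_prod_topology (I : Type) (T : I -> topologicalType)
    (F : set_system (prod_topology T)) (t : prod_topology T) : Filter F ->
  (forall i, (fun f => f i) @ F --> t i) -> F --> t.
Proof.
move=> FF Ft; apply/cvg_sup => i.
exact: (@cvg_initial _ _ (fun f : forall i, T i => f i)).
Qed.

Lemma ultra_fmap (S T : Type) (f : S -> T) (F : set_system S) :
  UltraFilter F -> UltraFilter (f @ F).
Proof.
move=> FU; split=> [|G GF FG]; first exact: fmap_proper_filter.
apply/seteqP; split => // A GA; have [//|] := in_ultra_setVsetC (f @^-1` A) FU.
move=> FnA; have /FG GnA : (f @ F) (~` A) by [].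
by exfalso; apply: (filter_not_empty G); rewrite -(setICr A); exact: filterI.
Qed.

(** * Multilinear forms: boundedness, continuity and the unit ball *)

Section multilinear_maps.
Context {R : realType} {m : nat} {X : 'I_m -> completeNormedModType R}.
Implicit Types (x : forall j, X j).

Lemma multilinear_dfwithB (Y : lmodType R) (T : (forall j, X j) -> Y) x i u v :
  multilinear T ->
  T (dfwith x i (u - v)) = T (dfwith x i u) - T (dfwith x i v).
Proof.
by move=> /(_ i x (-1) v u); rewrite /= !scaleN1r [- v + u]addrC => ->; rewrite addrC.
Qed.

Lemma multilinear_dfwithZ (Y : lmodType R) (T : (forall j, X j) -> Y) x i a u :
  multilinear T -> T (dfwith x i (a *: u)) = a *: T (dfwith x i u).
Proof.
move=> lT; have T0 : T (dfwith x i 0) = 0.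
  by rewrite -(subrr 0) multilinear_dfwithB// subrr.
by have := lT i x a u 0; rewrite /= addr0 T0 addr0.
Qed.

(** Leads from [x] to [y] one coordinate at a time, so that each step is governed by linearity in a
    single argument. *)
Let hybrid (x y : forall j, X j) (k : nat) : forall j, X j :=
  fun j => if (j < k)%N then y j else x j.

Let hybrid0 x y : hybrid x y 0 = x.
Proof. by apply: functional_extensionality_dep. Qed.

Let hybridT x y : hybrid x y m = y.
Proof.
by apply: functional_extensionality_dep => j; rewrite /hybrid ltn_ord.
Qed.

Let hybridS x y (i : 'I_m) : hybrid x y i.+1 = dfwith (hybrid x y i) i (y i).
Proof.
apply: functional_extensionality_dep => j; rewrite /hybrid ltnS.
have [<-|ij] := eqVneq i j; first by rewrite leqnn dfwithin.
by rewrite dfwithout// leq_eqVlt (negbTE (_ : j != i :> nat))// eq_sym.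
Qed.

Let hybrid_id x y (i : 'I_m) : hybrid x y i = dfwith (hybrid x y i) i (x i).
Proof.
apply: functional_extensionality_dep => j.
have [<-|ij] := eqVneq i j; last by rewrite dfwithout.
by rewrite dfwithin /hybrid ltnn.
Qed.

Lemma multilinearZ (Y : lmodType R) (T : (forall j, X j) -> Y) (c : 'I_m -> R) x :
  multilinear T -> T (fun j => c j *: x j) = (\prod_j c j) *: T x.
Proof.
move=> lT; pose y := (fun j => c j *: x j) : forall j, X j.
have key k : (k <= m)%N ->
    T (hybrid x y k) = (\prod_(j < m | (j < k)%N) c j) *: T x.
  elim: k => [_|k ih km]; first by rewrite hybrid0 big_pred0// scale1r.
  pose i := Ordinal km; rewrite (hybridS x y i) multilinear_dfwithZ//.
  rewrite -hybrid_id ih ?(ltnW km)// scalerA; congr (_ *: _).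
  rewrite [RHS](bigD1 i)//=; congr (_ * _); apply: eq_bigl => j.
  by rewrite ltnS ltn_neqAle andbC.
have := key m (leqnn m); rewrite hybridT => ->; congr (_ *: _).
by apply: eq_bigl => j; rewrite ltn_ord.
Qed.

(** The radii [r j] are positive bounds on the norms rather than the norms themselves, so that
    dividing by them is legitimate even if some [x j] is 0. *)
Lemma multilinear_le (f : (forall j, X j) -> R) (M : R) (r : 'I_m -> R) x :
  multilinear (f : (forall j, X j) -> R^o) ->
  (forall x, (forall j, `|x j| <= 1) -> `|f x| <= M) ->
  (forall j, 0 < r j) -> (forall j, `|x j| <= r j) ->
  `|f x| <= (\prod_j r j) * M.
Proof.
move=> lf f1 r0 xr.
have -> : x = (fun j => r j *: ((r j)^-1 *: x j)).
  apply: functional_extensionality_dep => j.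
  by rewrite scalerA divff ?scale1r// gt_eqF.
rewrite (multilinearZ _ _ lf) normrZ ger0_norm ?prodr_ge0//; last first.
  by move=> j _; exact: ltW.
rewrite ler_wpM2l ?prodr_ge0// => [j _|]; first exact: ltW.
apply: f1 => j; rewrite normrZ ger0_norm ?invr_ge0 ?(ltW (r0 j))//.
by rewrite ler_pdivrMl ?mulr1; [exact: xr|exact: r0].
Qed.

(** Telescoping along hybrids, each difference is a value of [f] with one argument of norm at most
    [d] and the others of norm at most [1 + |x j|]; [multilinear_le] bounds it by [d * B]. *)
Lemma multilinear_bounded_continuous (f : (forall j, X j) -> R) :
  multilinear (f : (forall j, X j) -> R^o) ->
  (forall x, (forall j, `|x j| <= 1) -> `|f x| <= 1) ->
  continuous (f : prod_topology (fun j => X j) -> R).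
Proof.
move=> lf f1 x; pose B := \prod_j (1 + `|x j|).
have B0 : 0 < B by apply: prodr_gt0 => j _; rewrite ltr_pwDl.
have step (d : R) (y : forall j, X j) : 0 < d -> d <= 1 ->
    (forall j, `|y j - x j| <= d) -> `|f y - f x| <= m%:R * (d * B).
  move=> d0 d1 yd; have key k : (k <= m)%N ->
      `|f (hybrid x y k) - f x| <= k%:R * (d * B).
    elim: k => [_|k ih km]; first by rewrite hybrid0 subrr normr0 mul0r.
    pose i := Ordinal km.
    have -> : f (hybrid x y k.+1) - f x =
        (f (dfwith (hybrid x y i) i (y i - x i))) + (f (hybrid x y k) - f x).
      by rewrite (multilinear_dfwithB _ _ _ lf) -hybridS -hybrid_id/= addrA subrK.
    apply: (le_trans (ler_normD _ _)); rewrite -natr1 mulrDl mul1r addrC.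
    apply: lerD; first exact: ih (ltnW km).
    pose r j := if j == i then d else 1 + `|x j|.
    have r0 j : 0 < r j by rewrite /r; case: ifP => // _; rewrite ltr_pwDl.
    apply: (@le_trans _ _ ((\prod_j r j) * 1)).
      apply: multilinear_le => // j; rewrite /r.
      have [->|ji] := eqVneq j i; first by rewrite dfwithin.
      rewrite dfwithout 1?eq_sym// /hybrid; case: ifP => _; last by rewrite lerDr.
      rewrite -[y j](subrK (x j)); apply: (le_trans (ler_normD _ _)).
      by rewrite lerD2r (le_trans (yd j)).
    rewrite mulr1 /B (bigD1 i)//= [X in _ <= d * X](bigD1 i)//= {1}/r eqxx.
    rewrite ler_pM2l// (eq_bigr (fun j => 1 + `|x j|)) => [|j ji]; last first.
      by rewrite /r (negbTE ji).
    rewrite ler_peMl ?lerDl// prodr_ge0// => j _; exact: addr_ge0.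
  by have := key m (leqnn m); rewrite hybridT.
have FX : Filter (nbhs (x : prod_topology (fun j => X j))) by exact: nbhs_filter.
apply/(@cvgrPdist_lt _ _ _ _ FX) => e e0.
(* The factor [m.+1] keeps the denominator positive and the final bound strict, also when
   [m = 0]. *)
pose d := Num.min 1 (e / (m.+1%:R * B)).
have d0 : 0 < d by rewrite lt_min ltr01 divr_gt0// mulr_gt0.
have : \forall y \near (x : prod_topology (fun j => X j)),
    forall j, `|x j - y j| < d.
  apply: (@filter_forall _ _ _ _ FX) => j.
  apply: (@cvgr_dist_lt _ _ _ _ FX (fun y => y j)) => //.
  exact: (@proj_continuous _ (fun j => X j) j x).
apply: filterS => y yd; rewrite distrC.
apply: (@le_lt_trans _ _ (m%:R * (d * B))).
  apply: step => // [|j]; first by rewrite ge_min lexx.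
  by rewrite distrC ltW.
apply: (@lt_le_trans _ _ (m.+1%:R * (d * B))).
  by rewrite ltr_pM2r ?mulr_gt0// ltr_nat.
rewrite mulrCA -ler_pdivlMr ?mulr_gt0//.
by rewrite ge_min lexx orbT.
Qed.

Lemma multilinear_continuous_bounded (f : (forall j, X j) -> R) :
  multilinear (f : (forall j, X j) -> R^o) ->
  continuous (f : prod_topology (fun j => X j) -> R) ->
  exists M, forall x, (forall j, `|x j| <= 1) -> `|f x| <= M.
Proof.
move=> lf cf; pose z : prod_topology (fun j => X j) := fun j => 0.
pose box (d : R) := [set x : prod_topology (fun j => X j) | forall j, `|x j| < d].
(* The boxes generate a filter converging to 0 coordinatewise, so continuity at 0 supplies a box on
   which [f] stays within 1 of [f z]. *)
pose G := filter_from [set d : R | 0 < d] box.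
have FG : Filter G.
  apply: filter_from_filter; first by exists 1; rewrite /=.
  move=> a b /= a0 b0; exists (Num.min a b); first by rewrite /= lt_min a0.
  by move=> x xab; split=> j; have := xab j; rewrite lt_min => /andP[xa xb].
have Gz : G --> z.
  apply: cvg_prod_topology => j; apply/cvgrPdist_lt => e e0.
  by exists e => // x /(_ j); rewrite /z/= sub0r normrN.
have /cvgrPdist_lt/(_ _ ltr01) : f @ G --> f z.
  by apply: (cvg_comp _ _ Gz); exact: (cf z).
move=> [d /= d0 fd]; pose c := d / 2.
have c0 : 0 < c by rewrite divr_gt0.
(* Halving [d] puts every [c *: x j] strictly inside the box; multilinearity undoes the scaling at
   the cost of the product of the [c^-1]. *)
exists ((\prod_(j < m) c^-1) * (`|f z| + 1)) => x x1.
have -> : x = (fun j => c^-1 *: (c *: x j)).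
  apply: functional_extensionality_dep => j.
  by rewrite scalerA mulVf ?scale1r// gt_eqF.
rewrite (multilinearZ _ _ lf) normrZ ger0_norm ?prodr_ge0//; last first.
  by move=> j _; rewrite invr_ge0 ltW.
rewrite ler_wpM2l ?prodr_ge0// => [j _|]; first by rewrite invr_ge0 ltW.
have /fd/= : box d (fun j => c *: x j).
  move=> j; rewrite normrZ gtr0_norm//; apply: (@le_lt_trans _ _ c).
    by rewrite ger_pMr //; exact: x1.
  by rewrite /c; lra.
move=> /ltW fzx.
apply: (@le_trans _ _ `|f z - (f z - f (fun j => c *: x j))|).
  by rewrite opprB addrC subrK.
by apply: (le_trans (ler_normB _ _)); rewrite lerD2l.
Qed.

(** Boundedness and continuity imply each other for multilinear forms, so the continuity clause and
    the [sup] can be traded for pointwise conditions, which survive pointwise limits. *)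
Lemma form_ballP (f : (forall j, X j) -> R) :
  form_ball f <-> multilinear (f : (forall j, X j) -> R^o) /\
    forall x, (forall j, `|x j| <= 1) -> `|f x| <= 1.
Proof.
split=> [[[lf cf] f1]|[lf f1]]; split=> //.
- move=> x x1; apply: le_trans f1; apply: ub_le_sup; last by exists x.
  have [M fM] := multilinear_continuous_bounded lf cf.
  by exists M => _ [y y1 <-]; exact: fM.
- by split=> //; exact: multilinear_bounded_continuous.
- apply: ge_sup => [|_ [x x1 <-]]; last exact: f1.
  by exists `|f (fun=> 0)|, (fun=> 0) => // j; rewrite normr0.
Qed.

End multilinear_maps.

Section dual_ball_topology.
Context {R : realType} {m : nat} (X : 'I_m -> completeNormedModType R).
Local Notation K := (dual_ball X).

Lemma form_of_inj : injective (@form_of R m X).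
Proof. by move=> f g fg; exact: val_inj. Qed.

Lemma form_of_continuous x : continuous (fun f : K => form_of f x : R).
Proof.
have := @continuous_tensor_fun R m X 1 (fun=> 1) (fun=> x).
rewrite (_ : tensor_fun _ _ = (fun f : K => form_of f x))//.
by apply/funext => f; rewrite /tensor_fun big_ord1 mul1r.
Qed.

(** The topology is generated by the pairings, each a finite linear combination of evaluations. *)
Lemma dual_ball_cvg (F : set_system K) (f : K) : Filter F ->
  (forall x, form_of g x @[g --> F] --> (form_of f x : R)) -> F --> f.
Proof.
move=> FF Ff; apply: (@cvg_initial _ _ (@dual_ball_pairing R m X)).
apply: cvg_prod_topology => u.
have : \sum_(a <- u) a.1 * form_of g a.2 @[g --> F] -->
    (\sum_(a <- u) a.1 * form_of f a.2 : R); last exact.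
elim: u => [|a u ih].
  by under eq_fun do rewrite big_nil; rewrite big_nil; exact: cvg_cst.
under eq_fun do rewrite big_cons; rewrite big_cons.
by apply: cvgD => //; apply: cvgM; [exact: cvg_cst|exact: Ff].
Qed.

Lemma dual_ball_hausdorff : hausdorff_space K.
Proof.
move=> f g fg; apply/form_of_inj/funext => x; apply: (@Rhausdorff R) => A B Af Bg.
have := fg _ _ (form_of_continuous Af) (form_of_continuous Bg).
by move=> [h [Ah Bh]]; exists (form_of h x).
Qed.

(* Banach-Alaoglu *)
Lemma dual_ball_compact : compact [set: K].
Proof.
rewrite compact_ultra => F FU _.
have bound (f : K) x : `|form_of f x| <= \prod_j (1 + `|x j|).
  have [lf f1] := (form_ballP _).1 (set_valP f).
  by rewrite -[leRHS]mulr1; apply: multilinear_le => // j; rewrite lerDr.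
(* Along the ultrafilter each evaluation stays in a compact interval, hence converges; [g] collects
   the limits. *)
have /choice[g Fg] x : exists y : R, form_of f x @[f --> F] --> y.
  have := ultra_fmap (fun f : K => form_of f x) FU => FUx.
  have := @segment_compact R (- \prod_j (1 + `|x j|)) (\prod_j (1 + `|x j|)).
  rewrite compact_ultra => /(_ _ FUx)[|y [_ Fy]]; last by exists y.
  suff : \forall f \near F, `[- \prod_j (1 + `|x j|), \prod_j (1 + `|x j|)]%classic
      (form_of f x : R) by [].
  by apply: filterE => f /=; rewrite in_itv/= -ler_norml; exact: bound.
have gball : form_ball g.
  apply/form_ballP; split=> [i x a u v|x x1].
    apply: (cvg_unique (@Rhausdorff R) (Fg _)).
    have -> : (fun f : K => form_of f (dfwith x i (a *: u + v))) =
        (fun f : K => a * form_of f (dfwith x i u) + form_of f (dfwith x i v)).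
      by apply/funext => f; have [lf _] := (form_ballP _).1 (set_valP f); exact: lf.
    by apply: cvgD => //; apply: cvgM => //; exact: cvg_cst.
  have : closed [set y : R | `|y| <= 1].
    by apply: (preimage_closed _ (@closed_le R 1)) => y _; exact: norm_continuous.
  move=> cl1; have FF : ProperFilter F := ultra_proper.
  apply: (@closed_cvg _ _ F _ (fun f : K => form_of f x) _ cl1 _ _ (Fg x)).
  by apply: nearW => f; have [_] := (form_ballP _).1 (set_valP f); apply.
by exists (SigSub (mem_set gball) : K); split => //; exact: dual_ball_cvg.
Qed.

End dual_ball_topology.

(** * The domination theorem *)

(** Differentiability of the power settles [y != 0]; at 0 the bound |z|^p <= |z| for |z| <= 1 is
    used, which rests on [1 <= p]. *)
Lemma norm_powR_continuous (R : realType) (p : R) : 1 <= p ->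
  continuous (fun y : R => `|y| `^ p).
Proof.
move=> p1 y; have [->|y0] := eqVneq y 0.
  apply/cvgrPdist_lt => e e0; rewrite normr0 powR0; last first.
    by rewrite gt_eqF// (lt_le_trans _ p1).
  have : \forall z \near (0 : R), `|z| < Num.min 1 e.
    apply: (@cvgr0_norm_lt _ _ _ (nbhs (0 : R)) _ id); first exact: cvg_id.
    by rewrite lt_min ltr01.
  apply: filterS => z; rewrite lt_min => /andP[/ltW z1 ze].
  rewrite sub0r normrN ger0_norm ?powR_ge0//; apply: le_lt_trans ze.
  have [->|z0] := eqVneq z 0.
    by rewrite normr0 powR0// gt_eqF// (lt_le_trans _ p1).
  by apply: ge1r_powR => //; rewrite normr_gt0 z0.
apply: (@continuous_comp _ _ _ (fun y : R => `|y|) (fun z : R => z `^ p)).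
  exact: (@norm_continuous _ R^o).
apply: differentiable_continuous; apply/derivable1_diffP.
have y0' : 0 < `|y| by rewrite normr_gt0.
by have [] := is_derive1_powR p y0'.
Qed.

Lemma le_root_powR (R : realType) (p x C t : R) : 1 <= p ->
  0 <= x -> 0 <= C -> 0 <= t ->
  (x <= C * t `^ p^-1) = (x `^ p <= C `^ p * t).
Proof.
move=> p1 x0 C0 t0; have p0 : 0 < p by exact: lt_le_trans p1.
have pK y : 0 <= y -> (y `^ p^-1) `^ p = y.
  by move=> y0; rewrite -powRrM mulVf ?powRr1// gt_eqF.
have -> : C `^ p * t = (C * t `^ p^-1) `^ p by rewrite powRM ?powR_ge0// pK.
have Ct0 : 0 <= C * t `^ p^-1 by rewrite mulr_ge0 ?powR_ge0.
apply/idP/idP => [h|h]; first by apply: ge0_ler_powR => //; exact: ltW.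
rewrite leNgt; apply/negP => lt_x.
have := gt0_ltr_powR p0 (x := C * t `^ p^-1) (y := x) Ct0 x0 lt_x.
by rewrite ltNge h.
Qed.

(** The maximum of [h] times the total mass 1 is a bound. A real value lets the extended-real root
    become a real one. *)
Lemma integral_continuous_EFin (R : realType) (K : ptopologicalType)
    (eta : probability (borel_type K) R) (h : K -> R) :
  compact [set: K] -> continuous h -> (forall x, 0 <= h x) ->
  exists r : R, (\int[eta]_x (h x)%:E = r%:E)%E.
Proof.
move=> cK ch h0; have [c hc] := compact_max cK ch.
exists (fine (\int[eta]_x (h x)%:E)%E); rewrite fineK//.
rewrite ge0_fin_numE; last by apply: integral_ge0 => x _; rewrite lee_fin.
apply: (@le_lt_trans _ _ (\int[eta]_x (cst (h c)%:E x))%E).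
  apply: ge0_le_integral => //.
  - by move=> x _; rewrite lee_fin.
  - by apply/measurable_EFinP; exact: cts_borel_measurable.
  - by move=> x _; rewrite lee_fin.
by rewrite integral_cst// [X in (_ * X)%E]probability_setT mule1 ltry.
Qed.

(** * Padding finite sums to a common length *)

Section common_length.
Context {R : realType} {m : nat} {X : 'I_m -> completeNormedModType R}.

Definition pad_coef n (a : 'I_n -> R) N (k : 'I_N) : R :=
  oapp a 0 (insub (k : nat)).

Definition pad_vec n (x : 'I_n -> forall j, X j) N (k : 'I_N) : forall j, X j :=
  oapp x (fun=> 0) (insub (k : nat)).

Lemma sum_pad (V : lmodType R) (F : (forall j, X j) -> V) n N
    (a : 'I_n -> R) (x : 'I_n -> forall j, X j) : (n <= N)%N ->
  \sum_(k < N) pad_coef a k *: F (pad_vec x k) = \sum_(k < n) a k *: F (x k).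
Proof.
move=> nN; pose G (k : nat) := oapp a 0 (insub k) *: F (oapp x (fun=> 0) (insub k)).
transitivity (\sum_(k < n) G k); last first.
  by apply: eq_bigr => k _; rewrite /G valK.
rewrite (big_ord_widen N G nN) [LHS](bigID (fun k : 'I_N => (k < n)%N))/=.
rewrite [X in _ + X]big1 ?addr0// => k kn.
by rewrite /pad_coef insubN// scale0r.
Qed.

(** Both sides have to be the same element of [Vm], because [Phi] is merely a map and can only be
    rewritten along equalities. *)
Lemma tensor_V_pad n N (a : 'I_n -> R) (x : 'I_n -> forall j, X j) :
  (n <= N)%N -> tensor_V (pad_coef a (N := N)) (pad_vec x (N := N)) = tensor_V a x.
Proof.
move=> nN; apply/val_inj/continuousEP => f /=.
exact: (@sum_pad R^o (form_of f)).
Qed.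

Lemma scale_tensor_V c n (a : 'I_n -> R) (x : 'I_n -> forall j, X j) :
  scale_V c (tensor_V a x) = tensor_V (fun k => c * a k) x.
Proof.
apply/val_inj/continuousEP => f /=; rewrite /scale_cts /mkcts/= /tensor_fun.
by rewrite mulr_sumr; apply: eq_bigr => k _; rewrite mulrA.
Qed.

End common_length.

Section domination.
Context {R : realType} {m : nat} {X : 'I_m -> completeNormedModType R}.
Context {Y : completeNormedModType R}.
Variables (p : R) (T : (forall j, X j) -> Y).
Variable Phi : Vm X -> continuousType (dual_ball X) R.
Hypothesis p1 : 1 <= p.
Local Notation K := (dual_ball X).

(* A representative [\sum_k a_k x_k^1 (x) ... (x) x_k^m] bundled with its
   length, so that a finite family may mix lengths. *)
Definition rep := {n : nat & (('I_n -> R) * ('I_n -> forall j, X j))%type}.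

Definition mk_rep n (a : 'I_n -> R) (x : 'I_n -> forall j, X j) : rep :=
  Tagged (fun n => (('I_n -> R) * ('I_n -> forall j, X j))%type) (a, x).

Definition rep_V (w : rep) : Vm X := tensor_V (tagged w).1 (tagged w).2.

Definition rep_T (w : rep) : Y :=
  \sum_(k < tag w) (tagged w).1 k *: T ((tagged w).2 k).

Definition rep_Phi (w : rep) (f : K) : R := `|Phi (rep_V w) f| `^ p.

Definition rep_scale (c : R) (w : rep) : rep :=
  mk_rep (fun k => c * (tagged w).1 k) (tagged w).2.

Lemma rep_Phi_continuous w : continuous (rep_Phi w).
Proof.
move=> f; apply: (@continuous_comp _ _ _ (Phi (rep_V w)) (fun y : R => `|y| `^ p)).
  exact: cts_fun.
exact: norm_powR_continuous.
Qed.

Lemma sum_rep_Phi_continuous (ws : seq rep) :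
  continuous (fun f => \sum_(w <- ws) rep_Phi w f).
Proof.
elim: ws => [|w ws ih].
  by under eq_fun do rewrite big_nil; exact: cst_continuous.
under eq_fun do rewrite big_cons.
by apply: cts_add; [exact: rep_Phi_continuous|exact: ih].
Qed.

(** The root is increasing, so it is largest where [S] is; the sup norm thereby becomes the value at
    one point. *)
Lemma sup_norm_max (S : K -> R) : continuous S -> (forall f, 0 <= S f) ->
  exists2 f, forall g, S g <= S f &
    sup_norm (fun g => S g `^ p^-1) = S f `^ p^-1.
Proof.
move=> cS S0; have [f Sf] := compact_max (@dual_ball_compact R m X) cS.
exists f => //; apply/eqP; rewrite eq_le; apply/andP; split.
  apply: ge_sup; first by exists `|S f `^ p^-1|, f.
  move=> _ [g _ <-]; rewrite ger0_norm ?powR_ge0//.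
  by rewrite ge0_ler_powR ?invr_ge0 ?(le_trans _ p1) ?nnegrE.
apply: ub_le_sup; last by exists f => //; rewrite ger0_norm ?powR_ge0.
exists (S f `^ p^-1) => _ [g _ <-]; rewrite ger0_norm ?powR_ge0//.
by rewrite ge0_ler_powR ?invr_ge0 ?(le_trans _ p1) ?nnegrE.
Qed.

Lemma rep_T_scale c w : rep_T (rep_scale c w) = c *: rep_T w.
Proof.
by rewrite /rep_T scaler_sumr; apply: eq_bigr => k _; rewrite scalerA.
Qed.

Lemma rep_Phi_scale c w f : homogeneous Phi -> 0 < c ->
  rep_Phi (rep_scale c w) f = c `^ p * rep_Phi w f.
Proof.
move=> hPhi c0; rewrite /rep_Phi /rep_V/= -scale_tensor_V hPhi//.
by rewrite /scale_cts /mkcts/= normrM gtr0_norm// powRM// ltW.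
Qed.

(* Padding with zeros makes the common length [n2] immaterial. *)
Lemma strongly_summingP : strongly_summing Phi p T <->
  exists2 C : R, 0 < C & forall ws : seq rep, exists f : K,
    \sum_(w <- ws) `|rep_T w| `^ p <= C `^ p * \sum_(w <- ws) rep_Phi w f.
Proof.
have p0 : 0 < p by exact: lt_le_trans p1.
have pK y : 0 <= y -> (y `^ p^-1) `^ p = y.
  by move=> y0; rewrite -powRrM mulVf ?powRr1// gt_eqF.
have sumT0 (ws : seq rep) : 0 <= \sum_(w <- ws) `|rep_T w| `^ p.
  by apply: sumr_ge0 => w _; exact: powR_ge0.
have sumP0 (ws : seq rep) f : 0 <= \sum_(w <- ws) rep_Phi w f.
  by apply: sumr_ge0 => w _; exact: powR_ge0.
split=> -[C C0 H]; exists C => //.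
  move=> ws; pose w i := tnth (in_tuple ws) i.
  pose N := (\max_i tag (w i))%N.
  have wN i : (tag (w i) <= N)%N by exact: leq_bigmax.
  have := H _ N (fun i => pad_coef (tagged (w i)).1 (N := N))
    (fun i => pad_vec (tagged (w i)).2 (N := N)).
  under eq_bigr do rewrite sum_pad//.
  have [f _] := sup_norm_max (@sum_rep_Phi_continuous ws) (sumP0 ws).
  rewrite (_ : (fun g => _) = fun g => (\sum_(i < size ws)
    `|Phi (tensor_V (pad_coef (tagged (w i)).1 (N := N))
      (pad_vec (tagged (w i)).2 (N := N))) g| `^ p) `^ p^-1).
    move=> ->; rewrite le_root_powR ?powR_ge0 ?(ltW C0)// pK => [h|].
      by exists f; rewrite big_tnth.
    by apply: sumr_ge0 => i _; exact: powR_ge0.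
  apply/funext => g; congr (_ `^ _); rewrite big_tnth; apply: eq_bigr => i _.
  by rewrite tensor_V_pad.
move=> n1 n2 a x.
pose ws : seq rep := [seq mk_rep (a i) (x i) | i <- enum 'I_n1].
have [f fmax sup_ws] := sup_norm_max (@sum_rep_Phi_continuous ws) (sumP0 ws).
have wsT : \sum_(w <- ws) `|rep_T w| `^ p =
    \sum_(i < n1) `|\sum_(k < n2) a i k *: T (x i k)| `^ p.
  by rewrite big_map big_enum.
have wsP g : \sum_(w <- ws) rep_Phi w g =
    \sum_(i < n1) `|Phi (tensor_V (a i) (x i)) g| `^ p.
  by rewrite big_map big_enum.
under [X in sup_norm X]eq_fun do rewrite -wsP.
rewrite sup_ws -wsT le_root_powR ?powR_ge0 ?(ltW C0)// pK//.
(* [H] provides some point [g]; the sum is at least as large at the maximum point [f]. *)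
have [g /le_trans] := H ws; apply.
by rewrite ler_wpM2l ?powR_ge0.
Qed.

End domination.

Theorem theorem3p2 (R : realType) (p : R) (hp : 1 <= p)
    (m : nat) (hm : (0 < m)%N)
    (X : 'I_m -> completeNormedModType R) (Y : completeNormedModType R)
    (T : (forall j, X j) -> Y) (hT : multilinear T)
    (Phi : Vm X -> continuousType (dual_ball X) R) (hPhi : homogeneous Phi) :
  strongly_summing Phi p T <->
  exists (eta : probability (borel_type (dual_ball X)) R) (C : R),
    [/\ regular_measure eta, 0 < C &
      forall (n : nat) (a : 'I_n -> R) (x : 'I_n -> forall j, X j),
        (`|\sum_(k < n) a k *: T (x k)|%:E <=
         C%:E * (\int[eta]_f (`|Phi (tensor_V a x) f| `^ p)%:E) `^ p^-1)%E].
Proof.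
pose nu w := `|rep_T T w| `^ p; pose P w f := rep_Phi p Phi w f.
have p0 : 0 < p by exact: lt_le_trans hp.
have pK y : 0 <= y -> (y `^ p^-1) `^ p = y.
  by move=> y0; rewrite -powRrM mulVf ?powRr1// gt_eqF.
have cP w : continuous (P w : dual_ball X -> R) by exact: rep_Phi_continuous.
have P0 w f : 0 <= P w f by exact: powR_ge0.
have hK := @dual_ball_hausdorff R m X; have cK := @dual_ball_compact R m X.
have intP (eta : probability (borel_type (dual_ball X)) R) w :
    exists2 r : R, 0 <= r & (\int[eta]_f (P w f)%:E = r%:E)%E.
  have [r Ir] := integral_continuous_EFin eta cK (cP w) (P0 w).
  exists r => //; rewrite -lee_fin -Ir; apply: integral_ge0 => f _.
  by rewrite lee_fin.
rewrite strongly_summingP//; split=> [[C C0 H]|[eta [C [_ C0 H]]]].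
  pose Q : set (dual_ball X -> R) :=
    [set g | exists ws : seq (@rep R m X),
       g = fun f => \sum_(w <- ws) nu w - C `^ p * \sum_(w <- ws) P w f].
  have [||||eta [reg etaQ]] := @separating_measure R (dual_ball X) hK cK Q.
  - by exists [::]; apply/funext => f; rewrite !big_nil mulr0 subr0.
  - move=> _ _ [ws ->] [ws' ->]; exists (ws ++ ws'); apply/funext => f.
    by rewrite !big_cat/= mulrDr opprD addrACA.
  - move=> c _ c_ge0 [ws ->].
    (* [homogeneous] speaks of positive factors; the factor 0 is realised by the empty family. *)
    have [<-|c0] := eqVneq 0 c.
      by exists [::]; apply/funext => f; rewrite !big_nil mulr0 subr0 mul0r.
    have {}c0 : 0 < c by rewrite lt0r eq_sym c0.
    (* Both [nu] and [P] are homogeneous of degree [p] for positive factors, hence the scaling of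
       each representative by c^(1/p). *)
    exists (map (rep_scale (c `^ p^-1)) ws); apply/funext => f.
    rewrite mulrBr mulrCA !big_map.
    congr (_ - _ * _); rewrite mulr_sumr; apply: eq_bigr => w _.
      rewrite /nu rep_T_scale normrZ ger0_norm ?powR_ge0//.
      by rewrite powRM ?powR_ge0// pK// ltW.
    by rewrite /P rep_Phi_scale ?powR_gt0// pK// ltW.
  - by move=> _ [ws ->]; have [f] := H ws; exists f; rewrite subr_le0.
  exists eta, C; split => // n a x.
  pose w := mk_rep a x.
  have [r r0 Ir] := intP eta w.
  (* Domination at [w] is the case of the family consisting of [w] alone. *)
  have /(_ (nu w) (fun f => C `^ p * P w f)) := etaQ.
  have -> : (\int[eta]_f (C `^ p * P w f)%:E = (C `^ p * r)%:E)%E.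
    under eq_integral do rewrite EFinM.
    rewrite ge0_integralZl_EFin ?powR_ge0 ?Ir//.
      by move=> f _; rewrite lee_fin.
    by apply/measurable_EFinP; exact: cts_borel_measurable.
  rewrite lee_fin => key.
  rewrite [X in (X `^ _)%E]Ir poweR_EFin -EFinM lee_fin le_root_powR ?(ltW C0)//.
  apply: key => [||].
  - by apply: cts_mul => //; exact: cst_continuous.
  - by move=> f; rewrite mulr_ge0 ?powR_ge0.
  - by exists [:: w]; apply/funext => f; rewrite !big_seq1.
exists C => // ws.
have [f fmax] := compact_max cK (@sum_rep_Phi_continuous _ _ _ _ Phi hp ws).
exists f.
have /choice[r Pr] w : exists r : R, (\int[eta]_f (P w f)%:E = r%:E)%E.
  by have [r _ Ir] := intP eta w; exists r.
have r0 w : 0 <= r w.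
  by have [r' r'0] := intP eta w; rewrite Pr => -[->].
have nur w : nu w <= C `^ p * r w.
  have := H _ (tagged w).1 (tagged w).2.
  rewrite [X in (X `^ _)%E](Pr w) poweR_EFin -EFinM lee_fin.
  by rewrite le_root_powR ?(ltW C0).
apply: (@le_trans _ _ (C `^ p * \sum_(w <- ws) r w)).
  by rewrite mulr_sumr; apply: ler_sum => w _; exact: nur.
rewrite ler_wpM2l ?powR_ge0// -lee_fin -sumEFin.
have mP w : measurable_fun [set: borel_type (dual_ball X)] (EFin \o P w).
  by apply/measurable_EFinP; exact: cts_borel_measurable.
under eq_bigr do rewrite -Pr.
rewrite -ge0_integral_sum//; last by move=> w g _; rewrite lee_fin.
apply: (@le_trans _ _ (\int[eta]_x (cst (\sum_(w <- ws) P w f)%:E x))%E).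
  apply: ge0_le_integral => //.
  - by move=> g _; apply: sume_ge0 => w _; rewrite lee_fin.
  - exact: emeasurable_sum.
  - by move=> g _; rewrite sumEFin lee_fin; exact: fmax.
by rewrite integral_cst// [X in (_ * X)%E]probability_setT mule1.
Qed.
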